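(* If the order is a negative integer $s=-n$ with $n\in\mathbb N$, the fractional derivative of order $s$ of $ax^\alpha$ (in the sense of the first definition) is not unique. It depends on $n$ arbitrary constants $c_{-n},\dots,c_{-1}$: $$\frac{d^{-n}(ax^\alpha)}{dx^{-n}}=a\frac{d^{-n}x^\alpha}{dx^{-n}}=a\frac{\Gamma(\alpha+1)}{\Gamma(\alpha+n+1)}x^{\alpha+n}+\sum_{k=-n}^{-1}c_k\frac{x^{k+n}}{(k+n)!}.$$
   Context: First definition. For any $(s,\alpha)\in\mathbb Q\times\mathbb R\setminus\{(-1,-1)\}$ and $x\in\mathbb R^+$, a derivative of order $s$ of the function $f(x)=ax^\alpha$ (equal to $ae^{\alpha\ln x}$ for $x>0$, and at $x=0$ equal to $a$ if $\alpha=0$ and to $0$ if $\alpha\neq0$) is defined by $$\frac{d^s(ax^\alpha)}{dx^s}=a\frac{d^sx^\alpha}{dx^s}=a\frac{\Gamma(\alpha+1)}{\Gamma(\alpha-s+1)}x^{\alpha-s}+\sum_{k=-\infty}^{-1}c_k\frac{x^{k-s}}{\Gamma(k-s+1)},$$ where $\{c_k\}$ is a set of arbitrary constants with finite values. Here $\Gamma$ is the gamma function, and $1/\Gamma$ is taken to be $0$ at the poles of $\Gamma$.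
   Formalization: The equality with a·d^{-n}x^α/dx^{-n} is one of sets of functions; for a=0, where it fails, only one inclusion is claimed. The Gamma quotient is a limit when Γ(α+1) is at a pole; for α=-1,…,-n, where it is infinite, the coefficient is a fixed default value. *)

(* Defs.v *)
From HB Require Import structures.
From mathcomp Require Import all_boot all_order all_algebra.
From mathcomp Require Import all_classical all_reals all_analysis.

Set Implicit Arguments.
Unset Strict Implicit.
Unset Printing Implicit Defensive.

Import Order.TTheory GRing.Theory Num.Theory.
Import numFieldNormedType.Exports.

Local Open Scope classical_set_scope.
Local Open Scope ring_scope.

Definition euler_gamma (R : realType) (x : R) : R :=
  \int[lebesgue_measure]_(t in `]0, +oo[) (t `^ (x - 1) * expR (- t)).

(* For x <= 0 the functional equation is applied N times, N being the least
   natural number such that 0 < x + N: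
     Gamma x = Gamma (x + N) / (x * (x + 1) * ... * (x + N - 1)).
   At the poles x = 0, -1, -2, ... one factor of the denominator is 0, hence
   Gamma x = 0 there (as 0^-1 = 0), and (Gamma x)^-1 = 0 is the usual value of
   the reciprocal gamma function. *)
Definition Gamma (R : realType) (x : R) : R :=
  if 0 < x then euler_gamma x
  else let N := (Num.truncn (- x)).+1 in
       euler_gamma (x + N%:R) / \prod_(i < N) (x + i%:R).

Definition Gamma_pole (R : realType) (x : R) : Prop :=
  exists m : nat, x = - m%:R.

(* The coefficient Gamma p / Gamma q. When q alone is a pole it is 0. When p and
   q are both poles, the quotient is understood as a limit, for instance
   Gamma 0 / Gamma (-1) = -1, as in d(1/x)/dx = - 1/x^2. When p alone is a pole
   the quotient is infinite and the limit takes a default real value. *)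
Definition Gamma_ratio (R : realType) (p q : R) : R :=
  if `[< Gamma_pole p >] then lim (Gamma (p + h) / Gamma (q + h) @[h --> 0^'])
  else Gamma p / Gamma q.

(* Powers with real exponents are powR, for which 0 `^ 0 = 1 and 0 `^ b = 0
   when b != 0. *)
Definition complementary_term (R : realType) (s : rat) (c : int -> R) (x : R)
    (k : int) : R :=
  c k * (x `^ (k%:~R - ratr s) / Gamma (k%:~R - ratr s + 1)).

(* g is the derivative of order s of x |-> a x^alpha on [0, +oo[ given by the
   constants c; only the values c k with k <= -1 matter. The sum over
   k = -1, -2, ... is required to converge at every point. *)
Definition frac_deriv_with (R : realType) (s : rat) (a alpha : R)
    (c : int -> R) (g : R -> R) : Prop :=
  forall x : R, 0 <= x ->
    exists2 S : R,
      series (fun j : nat => complementary_term s c x (- j.+1%:Z)) @ \oo --> S &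
      g x = a * Gamma_ratio (alpha + 1) (alpha - ratr s + 1)
              * x `^ (alpha - ratr s) + S.

Definition frac_deriv (R : realType) (s : rat) (a alpha : R) (g : R -> R) :
    Prop :=
  exists c : int -> R, frac_deriv_with s a alpha c g.

(* Main.v *)
Require Import Defs.
From HB Require Import structures.
From mathcomp Require Import all_boot all_order all_algebra.
From mathcomp Require Import all_classical all_reals all_analysis.
From mathcomp Require Import measurable_realfun ring.

Set Implicit Arguments.
Unset Strict Implicit.
Unset Printing Implicit Defensive.

Import Order.TTheory GRing.Theory Num.Theory.
Import numFieldNormedType.Exports.

Local Open Scope classical_set_scope.
Local Open Scope ring_scope.

(** For s = -n the term of index k = -j of the complementary series is
    c_(-j) x^(n-j) / Gamma(n-j+1). If j <= n, the argument is a positive integer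
    and Gamma(n-j+1) = (n-j)!; if j > n, it is a pole and the term vanishes. So
    the series is a polynomial with the n coefficients c_(-n), ..., c_(-1), each
    divided by a factorial: this is [frac_deriv_withE]. The two values of Gamma
    are [Gamma_nat] and [Gamma_pole_eq0]; the first one needs the integral of
    t^m e^(-t) over the half-line, computed from an antiderivative
    ([gamma_integrand_primitive]).

    The remaining claims follow from that formula. A factor a can be moved into
    the constants, and out of them if a <> 0, which gives the homogeneity. The part in
    x^(alpha+n) does not depend on the constants, so two derivatives agree for
    x >= 0 exactly when their polynomial parts do, that is, when their
    coefficients do, a nonzero polynomial having finitely many roots
    ([complementary_sum_inj]). Since n > 0, constants all equal to 0 and
    constants all equal to 1 then give different derivatives. *)

(** The term of degree k+1 of the exponential series bounds the product by
    (k+1)! / t. *)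
Lemma cvgr_expn_expRN (R : realType) (k : nat) :
  t ^+ k * expR (- t) @[t --> (+oo : set_system R)] --> (0 : R).
Proof.
apply: (@squeeze_cvgr _ _ _ _ (fun=> 0) (fun t : R => (k.+1)`!%:R / t)).
- near=> t.
  have t0 : 0 < t by near: t; exact: nbhs_pinfty_gt.
  rewrite mulr_ge0 ?exprn_ge0 ?expR_ge0 ?(ltW t0)//=.
  rewrite ler_pdivlMr// mulrAC -exprSr expRN ler_pdivrMr ?expR_gt0//.
  rewrite mulrC -ler_pdivrMr ?ltr0n ?fact_gt0//.
  apply: le_trans (expR_ge1Dxn k (ltW t0)).
  by rewrite lerDr.
- exact: cvg_cst.
- rewrite -[X in _ --> X](mulr0 (k.+1)`!%:R).
  apply: cvgM; first exact: cvg_cst.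
  by apply/gtr0_cvgV0; [exact: nbhs_pinfty_gt|exact: cvg_id].
Unshelve. all: by end_near. Qed.

(** Integration by parts, read as a recursion on antiderivatives:
    F_(m+1) t = (m+1) F_m t - t^(m+1) e^(-t). The value at 0 then follows the
    recursion of the factorial, with no improper integral by parts. *)
Lemma gamma_integrand_primitive (R : realType) (m : nat) :
  exists F : R -> R,
    [/\ forall t : R, is_derive t 1 F (t ^+ m * expR (- t)),
        F t @[t --> +oo] --> (0 : R) & F 0 = - (m`!)%:R].
Proof.
elim: m => [|m [F [dF Foo F0]]].
  exists (fun t => - expR (- t)); split.
  - move=> t; apply: is_derive_eq.
    by rewrite expr0 /GRing.scale/=; ring.
  - by rewrite -oppr0; apply: cvgN; exact: cvgr_expR.
  - by rewrite oppr0 expR0 fact0.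
exists (fun t => m.+1%:R * F t - t ^+ m.+1 * expR (- t)); split.
- move=> t.
  rewrite (_ : (fun _ => _) =
      m.+1%:R \*: F - (@id R) ^+ m.+1 * (expR \o -%R)); last first.
    by apply/funext => u; rewrite !fctE.
  have dFt := dF t; apply: is_derive_eq.
  rewrite !fctE /GRing.scale/= exprS; ring.
- rewrite -[X in _ --> X](subrr 0) -[X in _ --> X - _](mulr0 m.+1%:R).
  by apply: cvgB; [apply: cvgM => //; exact: cvg_cst|exact: cvgr_expn_expRN].
- by rewrite F0 expr0n mul0r subr0 factS natrM mulrN.
Qed.

Lemma euler_gamma_nat (R : realType) (m : nat) :
  euler_gamma (m.+1%:R : R) = (m`!)%:R.
Proof.
have [F [dF Foo F0]] := gamma_integrand_primitive R m.
have cf : continuous (fun t : R => t ^+ m * expR (- t)).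
  move=> t; apply: cvgM; first exact: exprn_continuous.
  by apply: continuous_comp; [exact: opp_continuous|exact: continuous_expR].
rewrite /euler_gamma -natr1 addrK.
transitivity
  (\int[lebesgue_measure]_(t in `]0 : R, +oo[) (t ^+ m * expR (- t))).
  apply: eq_Rintegral => t; rewrite inE/= in_itv/= andbT => t0.
  by rewrite powR_mulrn// ltW.
(* The closed interval is the one for which the fundamental theorem of calculus
   is stated; passing to it on extended-real integrals asks for measurability
   only, while integrability is not yet known. *)
rewrite /Rintegral integral_itv_obnd_cbnd; last first.
  apply/measurable_EFinP/measurable_funTS.
  exact: continuous_measurable_fun.
rewrite -/(Rintegral _ _ _).
rewrite (@Rintegral_ge0_continuous_FTC2y R _ F 0 0).
- by rewrite F0 sub0r opprK.
- by move=> t t0; rewrite mulr_ge0 ?exprn_ge0 ?expR_ge0.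
- exact: continuous_subspaceT.
- exact: Foo.
- by move=> t _; exact: ex_derive.
- apply/cvg_at_right_filter/differentiable_continuous/derivable1_diffP.
  exact: ex_derive.
- by move=> t _; rewrite derive1E derive_val.
Qed.

Lemma Gamma_nat (R : realType) (m : nat) : Gamma (m.+1%:R : R) = (m`!)%:R.
Proof. by rewrite /Gamma ltr0Sn euler_gamma_nat. Qed.

(** At x = -m the shift is N = m+1, so the last factor x + m of the denominator
    is 0. *)
Lemma Gamma_pole_eq0 (R : realType) (x : R) : Gamma_pole x -> Gamma x = 0.
Proof.
move=> [m ->]; rewrite /Gamma oppr_gt0 ltrn0 opprK natrK.
by rewrite big_ord_recr/= addNr mulr0 invr0 mulr0.
Qed.

(** The index j = n is the constant term: x^0 = 1 holds at x = 0 too, as the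
    real power takes the value 1 there. *)
Lemma complementary_term_int (R : realType) (n : nat) (c : int -> R) (x : R)
    (j : nat) : 0 <= x ->
  complementary_term (- n%:R) c x (- j%:Z) =
  if (j <= n)%N then c (- j%:Z) * (x ^+ (n - j) / ((n - j)`!)%:R) else 0.
Proof.
move=> x0; rewrite /complementary_term.
rewrite !rmorphN/= ratr_nat opprK [- _ + _]addrC -[j%:Z%:~R]/(j%:R).
case: leqP => jn.
  by rewrite -natrB// natr1 powR_mulrn// Gamma_nat.
rewrite (Gamma_pole_eq0 (x := n%:R - j%:R + 1)) ?invr0 ?mulr0//.
(* n - j + 1 = - (j - (n + 1)), where j - (n + 1) is a natural number *)
exists (j - n.+1)%N; rewrite natrB// -natr1; ring.
Qed.

Lemma cvg_series_finite (R : realType) (u : nat -> R) (n : nat) :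
  (forall j, (n <= j)%N -> u j = 0) ->
  series u @ \oo --> \sum_(0 <= j < n) u j.
Proof.
move=> u0; apply: cvg_near_cst; near=> k.
have nk : (n <= k)%N by near: k; exact: nbhs_infty_ge.
rewrite /series/= (big_cat_nat _ nk)//= [X in _ + X]big_nat_cond.
by rewrite [X in _ + X]big1 ?addr0// => j /andP[/andP[nj _] _]; exact: u0.
Unshelve. all: by end_near. Qed.

(** The convergence required by the definition is automatic here, the series
    being a finite sum: hence an equivalence, for every choice of constants. *)
Lemma frac_deriv_withE (R : realType) (n : nat) (a alpha : R) (c : int -> R)
    (g : R -> R) :
  frac_deriv_with (- n%:R) a alpha c g <->
  forall x : R, 0 <= x ->
    g x = a * Gamma_ratio (alpha + 1) (alpha + n%:R + 1) * x `^ (alpha + n%:R)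
          + \sum_(1 <= j < n.+1) c (- j%:Z) * (x ^+ (n - j) / ((n - j)`!)%:R).
Proof.
have cvgS (x : R) : 0 <= x ->
    series (fun j => complementary_term (- n%:R) c x (- j.+1%:Z)) @ \oo -->
    \sum_(1 <= j < n.+1) c (- j%:Z) * (x ^+ (n - j) / ((n - j)`!)%:R).
  move=> x0; rewrite big_add1/=.
  rewrite (eq_big_nat _ _
      (F2 := fun j => complementary_term (- n%:R) c x (- j.+1%:Z))).
    apply: cvg_series_finite => j nj.
    by rewrite complementary_term_int// ltnNge nj.
  by move=> j /andP[_ jn]; rewrite complementary_term_int// jn.
have sE : alpha - ratr (- n%:R) = alpha + n%:R.
  by rewrite rmorphN/= ratr_nat opprK.
split=> [gP x x0|gE x x0].
  have [S cvg_S ->] := gP x x0.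
  by rewrite sE (cvg_unique _ cvg_S (cvgS x x0)).
by exists (\sum_(1 <= j < n.+1) c (- j%:Z) * (x ^+ (n - j) / ((n - j)`!)%:R));
  [exact: cvgS|rewrite gE// sE].
Qed.

Lemma complementary_sumZ (R : realType) (n : nat) (b : R) (c : int -> R)
    (x : R) :
  \sum_(1 <= j < n.+1) (b * c (- j%:Z)) * (x ^+ (n - j) / ((n - j)`!)%:R) =
  b * \sum_(1 <= j < n.+1) c (- j%:Z) * (x ^+ (n - j) / ((n - j)`!)%:R).
Proof. by rewrite mulr_sumr; apply: eq_bigr => j _; rewrite -mulrA. Qed.

Lemma poly_eq0_ge0 (R : realType) (p : {poly R}) :
  (forall x, 0 <= x -> p.[x] = 0) -> p = 0.
Proof.
move=> p0.
(* 0, 1, ..., size p - 1 are more roots than the degree of p allows. *)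
apply: (@roots_geq_poly_eq0 _ _ [seq i%:R | i <- iota 0 (size p)]).
- by apply/allP => x /mapP[i _ ->]; apply/eqP/p0.
- rewrite map_inj_uniq ?iota_uniq//.
  exact: (can_inj (@natrK R)).
- by rewrite size_map size_iota.
Qed.

(** The difference of the two sides is a polynomial in x whose coefficient of
    degree n - j is (c_(-j) - c'_(-j)) / (n-j)!. *)
Lemma complementary_sum_inj (R : realType) (n : nat) (c c' : int -> R) :
  (forall x : R, 0 <= x ->
    \sum_(1 <= j < n.+1) c (- j%:Z) * (x ^+ (n - j) / ((n - j)`!)%:R) =
    \sum_(1 <= j < n.+1) c' (- j%:Z) * (x ^+ (n - j) / ((n - j)`!)%:R)) ->
  forall j : nat, (1 <= j <= n)%N -> c (- j%:Z) = c' (- j%:Z).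
Proof.
move=> ccE j /andP[j0 jn].
pose p := \poly_(i < n)
  ((c (- (n - i)%:Z) - c' (- (n - i)%:Z)) / (i`!)%:R).
have p0 : p = 0.
  apply: poly_eq0_ge0 => x x0; move/eqP: (ccE x x0).
  rewrite -subr_eq0 -sumrB => /eqP <-.
  rewrite horner_poly -(big_mkord xpredT
    (fun i => (c (- (n - i)%:Z) - c' (- (n - i)%:Z)) / (i`!)%:R * x ^+ i)).
  rewrite big_add1/= big_nat_rev/=; apply: eq_big_nat => i /andP[_ iltn].
  rewrite add0n subKn// -mulrBl.
  by rewrite mulrAC mulrA.
have := congr1 (fun q : {poly R} => q`_(n - j)) p0.
rewrite coef_poly coef0 subKn// ltn_subrL j0 (leq_trans j0 jn) => /eqP.
rewrite mulf_eq0 invr_eq0 pnatr_eq0 gtn_eqF ?fact_gt0// orbF subr_eq0.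
by move=> /eqP.
Qed.

Theorem theorem3p2 (R : realType) (n : nat) (s : rat) (a alpha : R)
    (n_gt0 : (0 < n)%N) (s_def : s = - n%:R)
    (s_alpha : (s, alpha) <> (-1, -1)) :
  [/\ (* the formula, with the constants c_{-n}, ..., c_{-1} of the definition *)
      (forall (c : int -> R) (g : R -> R),
        frac_deriv_with s a alpha c g <->
        forall x : R, 0 <= x ->
          g x = a * Gamma_ratio (alpha + 1) (alpha + n%:R + 1)
                  * x `^ (alpha + n%:R)
                + \sum_(1 <= j < n.+1)
                    c (- j%:Z) * (x ^+ (n - j) / ((n - j)`!)%:R)),
      (* the derivative of a x^alpha is a times the derivative of x^alpha *)
      (forall h : R -> R,
        frac_deriv s 1 alpha h -> frac_deriv s a alpha (fun x => a * h x)),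
      (a != 0 -> forall g : R -> R, frac_deriv s a alpha g ->
        exists2 h : R -> R, frac_deriv s 1 alpha h &
          forall x : R, 0 <= x -> g x = a * h x),
      (* the derivative depends on exactly the n constants c_{-n}, ..., c_{-1} *)
      (forall (c c' : int -> R) (g g' : R -> R),
        frac_deriv_with s a alpha c g -> frac_deriv_with s a alpha c' g' ->
        ((forall x : R, 0 <= x -> g x = g' x) <->
         (forall j : nat, (1 <= j <= n)%N -> c (- j%:Z) = c' (- j%:Z)))) &
      (* the derivative is not unique *)
      (exists g g' : R -> R,
        [/\ frac_deriv s a alpha g, frac_deriv s a alpha g' &
            exists2 x : R, 0 <= x & g x <> g' x])].
Proof.
subst s; split.
- by move=> c g; exact: frac_deriv_withE.
- move=> h [c /frac_deriv_withE hE]; exists (fun k => a * c k).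
  apply/frac_deriv_withE => x x0.
  by rewrite hE// complementary_sumZ mul1r mulrDr !mulrA.
- move=> a0 g [c /frac_deriv_withE gE]; exists (fun x => a^-1 * g x).
    exists (fun k => a^-1 * c k); apply/frac_deriv_withE => x x0.
    by rewrite gE// complementary_sumZ mulrDr !mulrA mulVf.
  by move=> x _; rewrite mulrA mulfV// mul1r.
- move=> c c' g g' /frac_deriv_withE gE /frac_deriv_withE g'E; split.
    move=> gg'; apply: complementary_sum_inj => x x0.
    by have := gg' x x0; rewrite gE// g'E// => /addrI.
  move=> cc' x x0; rewrite gE// g'E//; congr (_ + _).
  by apply: eq_big_nat => j jn; rewrite cc'.
- pose T x : R :=
    a * Gamma_ratio (alpha + 1) (alpha + n%:R + 1) * x `^ (alpha + n%:R).
  pose G b x : R := T x +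
    \sum_(1 <= j < n.+1) b * (x ^+ (n - j) / ((n - j)`!)%:R).
  exists (G 0), (G 1); split.
  + by exists (fun=> 0); apply/frac_deriv_withE.
  + by exists (fun=> 1); apply/frac_deriv_withE.
  (* By injectivity, G 0 x = G 1 x for all x >= 0 would force the constants 0 and
     1 of index j = n to be equal. *)
  apply: contrapT => noX.
  have : (0 : R) = 1.
    apply: (@complementary_sum_inj R n (fun=> 0) (fun=> 1) _ n).
      move=> x x0; apply: (@addrI _ (T x)); apply: contrapT => GE.
      by apply: noX; exists x.
    by rewrite n_gt0 leqnn.
  by move/eqP; rewrite eq_sym oner_eq0.
Qed.
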